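(* Let $n\geq 2$ be an integer. The number of tame friezes of width $n$ over a finite field of order $q$ is $$\frac{(q-1)(q^{n-1}+(-1)^n)}{q+1}.$$
   Context: A frieze of width $n\geq 2$ over a commutative ring $R$ with identity is a function $\mathbf{F}\colon\{(i,j)\in\mathbb{Z}^2:0\leq i-j\leq n\}\to R$, $m_{i,j}=\mathbf{F}(i,j)$, with $m_{i,i}=m_{n+i,i}=0$ for all $i\in\mathbb{Z}$ and $m_{i,j}m_{i+1,j+1}-m_{i,j+1}m_{i+1,j}=1$ for $0<i-j<n$. It is tame if the 3-by-3 matrix with rows $i-1,i,i+1$ and columns $j-1,j,j+1$ of entries of $\mathbf{F}$ has determinant $0$ whenever $1<i-j<n-1$. Friezes are counted as functions (not up to translation). *)

(* Defs.v *)
From HB Require Import structures.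
From mathcomp Require Import all_boot all_order all_algebra.
From mathcomp Require Import all_classical.

Set Implicit Arguments.
Unset Strict Implicit.
Unset Printing Implicit Defensive.

Import Order.TTheory GRing.Theory Num.Theory.
Local Open Scope ring_scope.

Definition strip (n : nat) : Type :=
  {p : int * int | 0 <= p.1 - p.2 <= n%:Z}.

(* Total access to the entries of a function on the strip. The default value 0
   outside the strip is never read by [frieze] and [tame], whose index
   constraints keep every entry they mention inside the strip. *)
Definition entry (R : comPzRingType) (n : nat) (F : strip n -> R)
    (i j : int) : R :=
  oapp F 0 (insub (i, j)).

Record frieze (R : comPzRingType) (n : nat) (F : strip n -> R) : Prop := {
  frieze_diag0 : forall i : int, entry F i i = 0;
  frieze_diagn : forall i : int, entry F (n%:Z + i) i = 0;
  frieze_unimodular : forall i j : int, 0 < i - j < n%:Z ->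
    entry F i j * entry F (i + 1) (j + 1)
      - entry F i (j + 1) * entry F (i + 1) j = 1
}.

Definition tame (R : comPzRingType) (n : nat) (F : strip n -> R) : Prop :=
  forall i j : int, 1 < i - j < n%:Z - 1 ->
    \det (\matrix_(a < 3, b < 3)
            entry F (i - 1 + (a : nat)%:Z) (j - 1 + (b : nat)%:Z)) = 0.

Definition tame_friezes (R : comPzRingType) (n : nat) : set (strip n -> R) :=
  [set F | frieze F /\ tame F]%classic.

Arguments tame_friezes R n : clear implicits.

(* Main.v *)
Require Import Defs.
From HB Require Import structures.
From mathcomp Require Import all_boot all_order all_algebra.
From mathcomp Require Import all_classical.
From mathcomp Require Import finmap ring zify.
Import Order.TTheory GRing.Theory Num.Theory.
Local Open Scope ring_scope.

(** Read the frieze by columns: put [c j d = m_(j+d,j)], for [0 <= d <= n].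

    A tame frieze is determined by two consecutive columns. In a 3-by-3 block
    of zero determinant, the corner entry of the third column is multiplied by
    a 2-by-2 minor of the first two columns, and unimodularity says that this
    minor is 1; so the third column can be computed entry by entry
    ([next_column]). The half-turn [c j d -> c (-j) (n-d)] preserves tame
    friezes, so the same argument runs to the left ([columns_determined]). A
    frieze is therefore encoded by the vectors
    [w_d = (m_(d+1,0), m_(d+1,1))], [0 <= d < n] ([code_inj]). They satisfy
    [w_0 = (x, 0)] with [x <> 0], the first coordinate of [w_(n-1)] is 0, and
    consecutive vectors have determinant 1.

    Conversely every such walk is a code ([code_onto]). The lines spanned by
    the [w_d] form a closed walk of length [n] in the projective line, in
    which consecutive lines are distinct. Repeat it periodically and choose on
    each line a vector [V_i] so that [det (V_i, V_(i+1)) = 1] for all integers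
    [i]; this is possible because rescaling one vector forces the scale of both
    neighbours ([closed_walk_lift]). Up to scalars [t_j] with
    [t_j t_(j+1) = 1], the entries of the frieze are the determinants of [V_j]
    and [V_i]: unimodularity is then the Pluecker relation, tameness
    holds because three vectors of a plane are linearly dependent, and the
    zeros on the two borders express that [V_j] and [V_(j+n)] are
    proportional.

    It remains to count walks ([size_walks]). From a vector outside the line
    of equation [x = 0] there are [q] steps of determinant 1, exactly one of
    which ends on that line; from a nonzero vector of that line all [q] steps
    leave it. Hence the number [b_m] of walks of [m] steps from outside the line
    into it satisfies [(q + 1) b_m = q^m - (-1)^m], and the number of friezes is
    [(q - 1) b_(n-1)], the factor [q - 1] being the choice of [x]. *)

Set Implicit Arguments.
Unset Strict Implicit.

(** * Friezes read by columns *)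

Definition det3 (R : comNzRingType) (a b c d e f g h i : R) : R :=
  a * (e * i - f * h) - b * (d * i - f * g) + c * (d * h - e * g).

Lemma det_mx33 (R : comNzRingType) (f : nat -> nat -> R) :
  \det (\matrix_(a < 3, b < 3) f a b) =
  det3 (f 0 0) (f 0 1) (f 0 2) (f 1 0) (f 1 1) (f 1 2) (f 2 0) (f 2 1) (f 2 2).
Proof.
rewrite (expand_det_row _ ord0) !big_ord_recl big_ord0 /cofactor.
rewrite !(expand_det_row _ ord0) !big_ord_recl !big_ord0 /cofactor !det_mx11.
rewrite !mxE /= /bump /= /det3; ring.
Qed.

(** Tame friezes in the coordinates [c j d], the entry of column [j] at
    distance [d] from the diagonal. The distance is a natural number, so that
    columns can be treated by induction, and the index bounds of the frieze
    become bounds on [d] alone. *)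
Record tame_columns (R : comNzRingType) (n : nat) (c : int -> nat -> R) : Prop :=
  TameColumns {
  columns0 : forall j, c j 0 = 0;
  columnsn : forall j, c j n = 0;
  columns_unimodular : forall j d, (d.+2 <= n)%N ->
    c j d.+1 * c (j + 1) d.+1 - c (j + 1) d * c j d.+2 = 1;
  columns_tame : forall j d, (d.+4 <= n)%N ->
    det3 (c j d.+2) (c (j + 1) d.+1) (c (j + 2) d)
         (c j d.+3) (c (j + 1) d.+2) (c (j + 2) d.+1)
         (c j d.+4) (c (j + 1) d.+3) (c (j + 2) d.+2) = 0
}.

Definition columns (R : comNzRingType) (n : nat) (F : strip n -> R)
    (j : int) (d : nat) : R :=
  entry F (j + d%:Z) j.

Lemma tame_friezes_columns (R : comNzRingType) (n : nat) (F : strip n -> R) :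
  tame_friezes R n F <-> tame_columns n (columns F).
Proof.
set c := columns F.
have detE i j d : i = j + d.+3%:Z ->
    \det (\matrix_(a < 3, b < 3)
            entry F (i - 1 + (a : nat)%:Z) (j + (b : nat)%:Z)) =
    det3 (c j d.+2) (c (j + 1) d.+1) (c (j + 2) d)
         (c j d.+3) (c (j + 1) d.+2) (c (j + 2) d.+1)
         (c j d.+4) (c (j + 1) d.+3) (c (j + 2) d.+2).
  move=> ->; rewrite (det_mx33 (fun a b => entry F (_ + a%:Z) (j + b%:Z))).
  by rewrite /c /columns; congr det3; congr entry; lia.
have detU i j d : i = j + d.+1%:Z ->
    entry F i j * entry F (i + 1) (j + 1) - entry F i (j + 1) * entry F (i + 1) j
    = c j d.+1 * c (j + 1) d.+1 - c (j + 1) d * c j d.+2.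
  by move=> ->; rewrite /c /columns; congr (_ * _ - _ * _); congr entry; lia.
split=> [[[F0 Fn Fu] Ft]|[C0 Cn Cu Ct]].
  split=> [j|j|j d dn|j d dn].
  - by rewrite -[RHS](F0 j); congr entry; lia.
  - by rewrite -[RHS](Fn j); congr entry; lia.
  - by rewrite -(detU _ j d erefl) Fu //; lia.
  - by rewrite -(detE _ j d erefl) -{2}(addrK 1 j) Ft //; lia.
split; first split.
- by move=> i; rewrite -[RHS](C0 i); congr entry; lia.
- by move=> i; rewrite -[RHS](Cn i); congr entry; lia.
- move=> i j ijn.
  have [d ijE dn] : exists2 d : nat, i = j + d.+1%:Z & (d.+2 <= n)%N.
    by exists (absz (i - j - 1)%R); lia.
  by rewrite (detU _ _ _ ijE) Cu.
- move=> i j ijn.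
  have [d ijE dn] : exists2 d : nat, i = j - 1 + d.+3%:Z & (d.+4 <= n)%N.
    by exists (absz (i - j - 2)%R); lia.
  by rewrite (detE _ _ _ ijE) Ct.
Qed.

(** * Two consecutive columns determine a tame frieze *)

(** The half-turn of the strip. It sends a 2-by-2 or 3-by-3 block to a block
    with its rows and its columns reversed, which has the same determinant; it
    turns every statement about the next column into one about the previous
    column. *)
Lemma tame_columns_rev (R : comNzRingType) (n : nat) (c : int -> nat -> R) :
  tame_columns n c -> tame_columns n (fun j d => c (- j) (n - d)%N).
Proof.
case=> C0 Cn Cu Ct; split=> [j|j|j d dn|j d dn].
- by rewrite subn0 Cn.
- by rewrite subnn C0.
- have := Cu (- j - 1) (n - d.+2)%N; rewrite subrK.
  rewrite -(_ : - (j + 1) = - j - 1); last by lia.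
  rewrite -(_ : (n - d = (n - d.+2).+2)%N); last by lia.
  rewrite -(_ : (n - d.+1 = (n - d.+2).+1)%N); last by lia.
  by move=> /(_ _) <-; [ring|lia].
- have := Ct (- j - 2) (n - d.+4)%N; rewrite subrK.
  rewrite -(_ : - (j + 2) = - j - 2); last by lia.
  rewrite (_ : - (j + 2) + 1 = - (j + 1)); last by lia.
  rewrite -(_ : (n - d = (n - d.+4).+4)%N); last by lia.
  rewrite -(_ : (n - d.+1 = (n - d.+4).+3)%N); last by lia.
  rewrite -(_ : (n - d.+2 = (n - d.+4).+2)%N); last by lia.
  rewrite -(_ : (n - d.+3 = (n - d.+4).+1)%N); last by lia.
  by move=> /(_ _) <-; [rewrite /det3; ring|lia].
Qed.

Definition same_column (R : Type) (n : nat) (c c' : int -> nat -> R) (j : int) :=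
  forall d, (d <= n)%N -> c j d = c' j d.

(** The first and the last inner entry of a column are the inverses of the
    corresponding entries of the preceding column. Between them, expanding the
    3-by-3 determinants along the third column gives a three-term recurrence
    whose leading coefficient is a unimodular minor of the first two columns. *)
Lemma next_column (R : comNzRingType) (n : nat) (c c' : int -> nat -> R) j :
    tame_columns n c -> tame_columns n c' ->
    same_column n c c' j -> same_column n c c' (j + 1) ->
  same_column n c c' (j + 2).
Proof.
move=> [C0 Cn Cu Ct] [C0' Cn' Cu' Ct'] e0 e1.
have j2 : j + 1 + 1 = j + 2 by rewrite -addrA.
have inv_inj (a x y : R) : a * x = 1 -> a * y = 1 -> x = y.
  by move=> ax ay; rewrite -[x]mul1r -ay mulrAC ax mul1r.
have first_entry : (2 <= n)%N -> c (j + 2) 1 = c' (j + 2) 1.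
  move=> n2; apply: (inv_inj (c (j + 1) 1)).
    by have := Cu (j + 1) 0 n2; rewrite j2 C0 mul0r subr0.
  by have := Cu' (j + 1) 0 n2; rewrite j2 C0' mul0r subr0 e1 //; lia.
have last_entry d : d.+2 = n -> c (j + 2) d.+1 = c' (j + 2) d.+1.
  move=> dn; apply: (inv_inj (c (j + 1) d.+1)).
    by have := Cu (j + 1) d; rewrite j2 dn Cn mulr0 subr0; apply.
  have := Cu' (j + 1) d; rewrite j2 dn Cn' mulr0 subr0 e1; last by lia.
  by apply.
(* Two consecutive entries at once, as the recurrence has order two. *)
suff step d : (d < n)%N -> c (j + 2) d = c' (j + 2) d /\ c (j + 2) d.+1 = c' (j + 2) d.+1.
  case=> [|d] dn; first by rewrite C0 C0'.
  by case: (step d).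
elim: d => [|d IH] dn.
  split; first by rewrite C0 C0'.
  have [n1|n2] : n = 1%N \/ (2 <= n)%N by lia.
    by rewrite -n1 Cn Cn'.
  exact: first_entry.
have [ed ed1] := IH (ltnW dn); split=> //.
have [dn2|[dn3|dn4]] : n = d.+2 \/ n = d.+3 \/ (d.+4 <= n)%N by lia.
- by rewrite -dn2 Cn Cn'.
- exact: last_entry.
have det3E (a b p e f q g h : R) x y : a * e - b * f = 1 ->
    det3 a b p f e q g h x = 0 -> det3 a b p f e q g h y = 0 -> x = y.
  (* The two determinants differ by (a * e - b * f) * (x - y). *)
  move=> abef x0 y0; apply: subr0_eq.
  rewrite -[LHS]mul1r -abef -[RHS](subrr 0) -{1}x0 -y0 /det3; ring.
have := Ct j d dn4; have := Ct' j d dn4.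
rewrite -!e0 -?e1 -?ed -?ed1; try lia.
move=> t' t; apply: det3E t t'.
by rewrite Cu //; lia.
Qed.

Lemma columns_determined (R : comNzRingType) (n : nat) (c c' : int -> nat -> R) :
    tame_columns n c -> tame_columns n c' ->
    same_column n c c' 0 -> same_column n c c' 1 ->
  forall j, same_column n c c' j.
Proof.
have rightwards (a a' : int -> nat -> R) j : tame_columns n a -> tame_columns n a' ->
    same_column n a a' j -> same_column n a a' (j + 1) ->
    forall k : nat, same_column n a a' (j + k%:Z).
  move=> ta ta' e0 e1 k.
  suff [] : same_column n a a' (j + k%:Z) /\ same_column n a a' (j + k%:Z + 1) by [].
  elim: k => [|k [IH0 IH1]]; first by rewrite addr0.
  have -> : j + k.+1%:Z = j + k%:Z + 1 by lia.
  by split=> //; rewrite -addrA; apply: next_column.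
move=> tc tc' e0 e1 j; have [j0|j0] : 0 <= j \/ j <= 0 by lia.
  have -> : j = 0 + (absz j)%:Z by lia.
  exact: rightwards.
move=> d dn.
have := rightwards _ _ (-1) (tame_columns_rev tc) (tame_columns_rev tc')
  _ _ (absz (1 - j)%R).
rewrite /same_column /= => /(_ _ _ (n - d)%N).
have -> : - (-1 + `|1 - j|%N%:Z) = j by lia.
rewrite subKn //; apply; last by lia.
- by move=> k kn; rewrite opprK e1 //; lia.
- by move=> k kn; rewrite addNr oppr0 e0 //; lia.
Qed.

(** Column 0 starts one row above column 1, hence the shift that aligns the
    rows. The two omitted entries, one per column, are zeros of the border. *)
Definition code (R : comNzRingType) (n : nat) (F : strip n -> R) : seq (R * R) :=
  mkseq (fun d => (columns F 0 d.+1, columns F 1 d)) n.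

Lemma code_inj (R : comNzRingType) (n : nat) :
  {in tame_friezes R n &, injective (@code R n)}.
Proof.
move=> F F' /set_mem/tame_friezes_columns tF /set_mem/tame_friezes_columns tF' FF'.
have codeE d : (d < n)%N ->
    columns F 0 d.+1 = columns F' 0 d.+1 /\ columns F 1 d = columns F' 1 d.
  move=> dn; have := congr1 (nth (0, 0) ^~ d) FF'.
  by rewrite /code !nth_mkseq // => -[].
have all_columns := columns_determined tF tF'.
apply/funext => -[[i j] ij]; have ij_le := ij; rewrite /= in ij_le.
have entryE (G : strip n -> R) : G (exist _ (i, j) ij) = columns G j (absz (i - j)%R).
  rewrite /columns /entry; have -> : j + `|i - j|%N%:Z = i.
    by lia.
  by rewrite insubT; congr (G _); apply: val_inj.
rewrite !entryE; apply: all_columns; last by lia.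
- case=> [|d] dn; first by rewrite (columns0 tF) (columns0 tF').
  by case: (codeE d dn).
- move=> d; rewrite leq_eqVlt => /orP[/eqP ->|dn].
    by rewrite (columnsn tF) (columnsn tF').
  by case: (codeE d dn).
Qed.

(** * From closed walks in the plane to friezes *)

Definition strip_of (R : comNzRingType) (n : nat) (c : int -> nat -> R) : strip n -> R :=
  fun p => c (val p).2 (absz ((val p).1 - (val p).2)%R).

Lemma columns_strip_of (R : comNzRingType) (n : nat) (c : int -> nat -> R) j d :
  (d <= n)%N -> columns (strip_of (n := n) c) j d = c j d.
Proof.
move=> dn; rewrite /columns /entry insubT /=; first by lia.
by move=> ?; rewrite /strip_of /=; congr c; lia.
Qed.

Lemma tame_strip_of (R : comNzRingType) (n : nat) (c : int -> nat -> R) :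
  tame_columns n c -> tame_friezes R n (strip_of (n := n) c).
Proof.
move=> [C0 Cn Cu Ct]; apply/tame_friezes_columns.
split=> [j|j|j d dn|j d dn]; rewrite !columns_strip_of; try lia.
- exact: C0.
- exact: Cn.
- exact: Cu.
- exact: Ct.
Qed.

Definition cross (R : comNzRingType) (u v : R * R) : R := u.1 * v.2 - u.2 * v.1.

(** Determinants of vectors of a plane form a tame frieze: unimodularity is
    the Pluecker relation
    [u u' * v v' = (u v) (u' v') - (u v') (u' v)], and the 3-by-3 blocks are
    products of a 3-by-2 and a 2-by-3 matrix. *)
Lemma tame_columns_cross (R : comNzRingType) (n : nat) (U V : int -> R * R) :
    (forall j, cross (U j) (U (j + 1)) = 1) ->
    (forall j, cross (V j) (V (j + 1)) = 1) ->
    (forall j, cross (U j) (V j) = 0) ->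
    (forall j, cross (U j) (V (j + n%:Z)) = 0) ->
  tame_columns n (fun j d => cross (U j) (V (j + d%:Z))).
Proof.
move=> U1 V1 UV0 UVn; split=> [j|j|j d _|j d _].
- by rewrite addr0.
- exact: UVn.
- rewrite -[RHS]mul1r -{1}(U1 j) -(V1 (j + d.+1%:Z)).
  have -> : j + 1 + d.+1%:Z = j + d.+1%:Z + 1 by lia.
  have -> : j + 1 + d%:Z = j + d.+1%:Z by lia.
  have -> : j + d.+2%:Z = j + d.+1%:Z + 1 by lia.
  rewrite /cross; ring.
- have -> : j + 1 + d.+1%:Z = j + d.+2%:Z by lia.
  have -> : j + 2 + d%:Z = j + d.+2%:Z by lia.
  have -> : j + 1 + d.+2%:Z = j + d.+3%:Z by lia.
  have -> : j + 2 + d.+1%:Z = j + d.+3%:Z by lia.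
  have -> : j + 1 + d.+3%:Z = j + d.+4%:Z by lia.
  have -> : j + 2 + d.+2%:Z = j + d.+4%:Z by lia.
  rewrite /cross /det3; ring.
Qed.

Definition scale (R : comNzRingType) (a : R) (v : R * R) : R * R := (a * v.1, a * v.2).

(** The solution, to one side of the origin, of
    [s k * s (k + 1) * delta k = 1] with [s 0 = a]. *)
Fixpoint rescaling (K : fieldType) (a : K) (delta : nat -> K) (k : nat) : K :=
  if k is k'.+1 then (rescaling a delta k' * delta k')^-1 else a.

(** Each scale determines the next and the previous one, so the scales are
    built from the origin in both directions. *)
Lemma rescaling_exists (K : fieldType) (a : K) (delta : int -> K) :
    a != 0 -> (forall i, delta i != 0) ->
  exists2 s : int -> K, s 0 = a & forall i, s i * s (i + 1) * delta i = 1.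
Proof.
move=> a0 d0.
have r0 (del : nat -> K) k : (forall l, del l != 0) -> rescaling a del k != 0.
  by move=> del0; elim: k => //= k IH; rewrite invr_neq0 // mulf_neq0.
exists (fun i => match i with
  | Posz k => rescaling a (fun l => delta (Posz l)) k
  | Negz k => rescaling a (fun l => delta (Negz l)) k.+1 end) => //.
case=> [k|[|k]].
- have -> : k%:Z + 1 = k.+1%:Z by lia.
  by rewrite /= mulrAC mulfV // mulf_neq0 // r0.
- have -> : Negz 0 + 1 = 0%:Z by lia.
  by rewrite /= -mulrA mulVf // mulf_neq0.
- have -> : Negz k.+1 + 1 = Negz k by lia.
  set b := rescaling a _ k.+1; have b0 : b != 0 by apply: r0.
  by rewrite /= -/b -mulrA mulVf // mulf_neq0.
Qed.

(** The bi-infinite walk that repeats the lines spanned by [w 0], ..., [w n],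
    with vectors rescaled so that consecutive determinants are 1 throughout,
    also at the seam where [w n] is followed by [w 0]. Rescaling starts from 1
    at the origin, so nothing changes within the first period. *)
Lemma closed_walk_lift (K : fieldType) (n : nat) (w : nat -> K * K) :
    (forall d, (d < n)%N -> cross (w d) (w d.+1) = 1) -> cross (w n) (w 0) != 0 ->
  exists V : int -> K * K,
    [/\ forall i, cross (V i) (V (i + 1)) = 1,
        forall i, cross (V i) (V (i + n.+1%:Z)) = 0,
        forall d, (d <= n)%N -> V d%:Z = w d
      & exists a, V (-1) = scale a (w n)].
Proof.
move=> w1 wn0; pose r (i : int) : nat := absz (i %% n.+1%:Z)%Z.
have rE (i : int) : (i %% n.+1%:Z)%Z = (r i)%:Z.
  by rewrite /r gez0_abs // modz_ge0.
have rn i : (r i <= n)%N by rewrite -ltnS -ltz_nat -rE ltz_pmod.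
have rD i : r (i + n.+1%:Z) = r i by rewrite /r modzDr.
have r_small (d : nat) : (d <= n)%N -> r d%:Z = d.
  by move=> dn; rewrite /r modz_nat modn_small.
have rS i : r (i + 1) = if (r i < n)%N then (r i).+1 else 0.
  rewrite /r -modzDml (rE i) -/(r i); have := rn i.
  have -> : (r i)%:Z + 1 = (r i).+1%:Z by lia.
  rewrite modz_nat /= leq_eqVlt => /orP[/eqP ->|rin]; first by rewrite modnn ltnn.
  by rewrite rin modn_small.
pose delta i := cross (w (r i)) (w (r (i + 1))).
have delta0 i : delta i != 0.
  rewrite /delta rS; case: ltnP => [rin|nri]; first by rewrite w1 ?oner_eq0.
  by have -> : r i = n by apply/eqP; rewrite eqn_leq rn.
have [s s0 sP] := rescaling_exists (oner_neq0 K) delta0.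
have s1 (d : nat) : (d <= n)%N -> s d%:Z = 1.
  elim: d => [//|d IH] dn; have := sP d%:Z.
  rewrite (IH (ltnW dn)) mul1r /delta rS (r_small d (ltnW dn)) dn w1 // mulr1.
  by have -> : d%:Z + 1 = d.+1%:Z by lia.
exists (fun i => scale (s i) (w (r i))); split=> [i|i|d dn|].
- by rewrite -(sP i) /delta /cross /=; ring.
- by rewrite rD /cross /=; ring.
- by rewrite s1 // r_small // /scale !mul1r -surjective_pairing.
- exists (s (-1)); congr (scale _ (w _)).
  rewrite -[LHS]rD -[RHS](r_small n) //; congr r; lia.
Qed.

(** The frieze is [m_(i,j) = t_(j-1) det (V_(j-1), V_(i-1))], where [V] lifts
    the walk and the [t_j] alternate between two inverse values. The choice
    [t_0 = 1 / x] is forced by [V_0 = w_0 = (x, 0)]: it makes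
    [U_1 = t_0 V_0 = (1, 0)], so that column 1 consists of second coordinates;
    likewise [U_0 = (0, -1)] and column 0 consists of first coordinates. *)
Lemma code_onto (K : fieldType) (m : nat) (s : seq (K * K)) :
    size s = m.+1 ->
    (forall d, (d < m)%N -> cross (nth (0, 0) s d) (nth (0, 0) s d.+1) = 1) ->
    (nth (0, 0) s 0).1 != 0 -> (nth (0, 0) s 0).2 = 0 -> (nth (0, 0) s m).1 = 0 ->
    (nth (0, 0) s m).2 != 0 ->
  exists2 F, tame_friezes K m.+1 F & code F = s.
Proof.
move=> size_s s1; set x := (nth _ _ 0).1 => x0 s02 sm1 sm2.
have [|V [V1 Vm Vs [a Va]]] := @closed_walk_lift K m (nth (0, 0) s) s1.
  by rewrite /cross sm1 s02 -/x mul0r sub0r oppr_eq0 mulf_neq0.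
have [t t0 tP] := @rescaling_exists K x^-1 (fun=> 1) (invr_neq0 x0) (fun=> oner_neq0 K).
pose U j := scale (t (j - 1)) (V (j - 1)).
have Um j : U (j + 1) = scale (t j) (V j) by rewrite /U addrK.
pose c j d := cross (U j) (V (j - 1 + d%:Z)).
have tc : tame_columns m.+1 c.
  rewrite (_ : c = fun j d => cross (U j) (V (j + d%:Z - 1))); last first.
    by apply/funext => j; apply/funext => d; rewrite /c addrAC.
  apply: (@tame_columns_cross K m.+1 U (fun j => V (j - 1))) => j.
  - have := V1 (j - 1); have := tP (j - 1); rewrite mulr1 Um subrK => tt1 <-.
    by rewrite /U -[RHS]mul1r -tt1 /cross /=; ring.
  - by rewrite addrAC V1.
  - by rewrite /U /cross /=; ring.
  - by rewrite addrAC /U -[RHS](mulr0 (t (j - 1))) -(Vm (j - 1)) /cross /=; ring.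
exists (strip_of (n := m.+1) c); first exact: tame_strip_of.
have V0 : V 0 = (x, 0) by rewrite (Vs 0%N) // [LHS]surjective_pairing s02.
have tN1 : t (-1) = x.
  have := tP (-1); rewrite mulr1 addNr t0 => tx.
  by rewrite -[RHS]mul1r -tx mulfVK.
have VN1 : V (-1) = (0, - x^-1).
  have := V1 (-1); rewrite addNr V0 Va /cross /= sm1 !mulr0 sub0r.
  rewrite /scale sm1 mulr0 => ax; congr (_, _).
  by apply: (mulIf x0); rewrite mulNr mulVf // -ax opprK.
apply: (@eq_from_nth _ (0, 0)); first by rewrite size_mkseq size_s.
move=> d; rewrite size_mkseq ltnS => dm.
rewrite nth_mkseq // !columns_strip_of //; last exact: ltnW.
rewrite /c /U sub0r subrr t0 tN1 V0 VN1.
rewrite (_ : -1 + d.+1%:Z = d%:Z) ?add0r ?Vs //; last by lia.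
rewrite [RHS]surjective_pairing /cross /=; congr (_, _).
  by rewrite mulr0 mul0r sub0r mulrN mulNr opprK mulfV // mul1r.
by rewrite mulr0 mul0r subr0 mulVf // mul1r.
Qed.

(** * Counting walks over a finite field *)

(** The continuations of [v] by [m] steps of determinant 1 that end with
    first coordinate 0. Listing them by their first step, rather than as a
    subset of all words, makes the recursion of the count definitional. *)
Fixpoint walks (K : finFieldType) (m : nat) (v : K * K) : seq (seq (K * K)) :=
  if m is m'.+1 then
    [seq u :: t | u <- enum [pred u | cross v u == 1], t <- walks m' u]
  else if v.1 == 0 then [:: [::]] else [::].

Lemma mem_walks (K : finFieldType) (m : nat) (v : K * K) (t : seq (K * K)) :
  (t \in walks m v) =
  [&& size t == m, path (fun u u' => cross u u' == 1) v t & (last v t).1 == 0].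
Proof.
elim: m v t => [|m IH] v [|u t] /=.
- by case: ifP.
- by case: ifP.
- by apply/negbTE/negP => /allpairsPdep[? [? []]].
- rewrite eqSS; apply/allpairsPdep/and3P => [[u' [t' []]]|].
    by rewrite mem_enum inE IH => vu /and3P[sz pt lt] [-> ->]; rewrite sz vu.
  move=> [sz /andP[vu pt] lt]; exists u, t.
  by rewrite mem_enum inE IH vu sz pt lt.
Qed.

Lemma uniq_cons_pairs (T : eqType) (s : seq T) (f : T -> seq (seq T)) :
  uniq s -> (forall x, uniq (f x)) -> uniq [seq x :: t | x <- s, t <- f x].
Proof.
move=> us uf; apply: allpairs_uniq_dep => // -[x t] [x' t'] _ _ /=.
by case=> -> ->.
Qed.

Lemma uniq_walks (K : finFieldType) (m : nat) (v : K * K) : uniq (walks m v).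
Proof.
elim: m v => [|m IH] v /=; first by case: ifP.
by apply: uniq_cons_pairs => //; apply: enum_uniq.
Qed.

Lemma size_cons_pairs (T : finType) (P : pred T) (f : T -> seq (seq T)) :
  size [seq x :: t | x <- enum P, t <- f x] = (\sum_(x | P x) size (f x))%N.
Proof. by rewrite size_allpairs_dep sumnE big_map big_enum. Qed.

(** Write [a_m] and [b_m] for the number of walks from a nonzero [v] with
    [v.1 = 0], respectively [v.1 <> 0]. Solving [cross v u = 1] for [u] gives an
    affine line. If [v.1 = 0], it lies in the region of nonzero first
    coordinate: [a_(m+1) = q b_m]. Otherwise the first coordinate is a
    parameter on it, and vanishes once: [b_(m+1) = a_m + (q - 1) b_m]. The
    closed forms are those of this recursion, multiplied by [q + 1] to stay in
    the integers. *)
Lemma size_walks (K : finFieldType) (m : nat) (v : K * K) : v != (0, 0) ->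
  (#|K|.+1%:Z * (size (walks m v))%:Z
   = #|K|%:Z ^+ m + (if v.1 == 0 then #|K|%:Z else -1) * (-1) ^+ m)%R.
Proof.
set q := #|K|.
have qE : q.+1%:Z = q%:Z + 1 by lia.
rewrite qE; elim: m v => [|m IH] [x y] v0.
  by rewrite /= !expr0; case: eqP => _ /=; ring.
have [x0|x0] := eqVneq x 0.
  have y0 : y != 0 by move: v0; rewrite x0 xpair_eqE eqxx.
  pose f z : K * K := (- y^-1, z).
  have sizeE : size (walks m.+1 (x, y)) = (\sum_(z : K) size (walks m (f z)))%N.
    rewrite /= size_cons_pairs (reindex_onto f snd) /=.
      apply: eq_bigl => z; rewrite /f /cross x0 /= mul0r sub0r mulrN opprK.
      by rewrite mulfV // !eqxx.
    move=> [a b]; rewrite /f /cross x0 /= mul0r sub0r => /eqP ya.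
    congr (_, _); apply: (mulfI y0); rewrite mulrN mulfV // -ya opprK //.
  rewrite sizeE (big_morph Posz PoszD (erefl _)) mulr_sumr.
  under eq_bigr => z _ do
    rewrite IH /= ?xpair_eqE ?oppr_eq0 ?invr_eq0 (negPf y0) //.
  rewrite sumr_const -[#|_|]/q -mulr_natl natz !exprS; ring.
pose f z : K * K := (z, (1 + y * z) / x).
have f0 z : f z != (0, 0).
  rewrite /f xpair_eqE negb_and; case: eqVneq => //= ->.
  by rewrite mulr0 addr0 mul1r invr_neq0.
have sizeE : size (walks m.+1 (x, y)) = (\sum_(z : K) size (walks m (f z)))%N.
  rewrite /= size_cons_pairs (reindex_onto f fst) /=.
    apply: eq_bigl => z; rewrite /f /cross /= [x * _]mulrC mulfVK //.
    by rewrite addrK !eqxx.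
  move=> [a b]; rewrite /f /cross /= => /eqP xb.
  by congr (_, _); rewrite -xb subrK mulrC mulKf.
rewrite sizeE (big_morph Posz PoszD (erefl _)) mulr_sumr.
under eq_bigr => z _ do rewrite IH //=.
rewrite (bigD1 0) //= eqxx.
under eq_bigr => z z0 do rewrite (negPf z0).
rewrite sumr_const -mulr_natl !exprS.
have -> : #|[pred z : K | z != 0]| = q.-1.
  by rewrite cardC1.
have -> : q.-1%:R = q%:Z - 1 :> int.
  by have : (0 < q)%N; [apply/card_gt0P; exists 0 | lia].
by ring.
Qed.

(** * Counting tame friezes *)

Definition codes (K : finFieldType) (m : nat) : seq (seq (K * K)) :=
  [seq u :: t | u <- enum [pred u : K * K | (u.1 != 0) && (u.2 == 0)],
                t <- walks m u].

(** The nonvanishing of the first coordinate of [w_0] and of the second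
    coordinate of [w_(n-1)] follows from the first and the last step having
    determinant 1. *)
Lemma mem_codes (K : finFieldType) (m : nat) (s : seq (K * K)) :
  reflect (exists2 F, tame_friezes K m.+2 F & code F = s) (s \in codes K m.+1).
Proof.
apply: (iffP allpairsPdep) => [[u [t []]]|[F tF <-]].
  rewrite mem_enum inE mem_walks => /andP[u1 /eqP u2].
  move=> /and3P[/eqP sz /(pathP (0, 0)) pt /eqP lt ->].
  have last_t : nth (0, 0) (u :: t) m.+1 = last u t by rewrite -sz nth_last.
  have steps d : (d < m.+1)%N ->
      cross (nth (0, 0) (u :: t) d) (nth (0, 0) (u :: t) d.+1) = 1.
    by rewrite -sz => dm; apply/eqP/pt.
  apply: code_onto; rewrite ?last_t //= ?sz //.
  apply: contra_eq_neq (steps m (ltnSn m)) => l2.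
  by rewrite last_t /cross lt l2 !mulr0 subr0 eq_sym oner_eq0.
have [C0 Cn Cu _] := (tame_friezes_columns F).1 tF.
exists (columns F 0 1, columns F 1 0).
exists (behead (code F)); split=> //.
  rewrite mem_enum inE /= C0 eqxx andbT.
  apply: contra_eq_neq (Cu 0 0 _) => // ->.
  by rewrite C0 !mul0r subr0 eq_sym oner_eq0.
rewrite mem_walks; apply/and3P; split.
- by rewrite size_behead size_mkseq.
- apply/(pathP (0, 0)) => d; rewrite size_behead size_mkseq => dm.
  rewrite -[_ :: behead _]/(code F) nth_behead !nth_mkseq //; last exact: ltnW.
  by rewrite /cross; apply/eqP/Cu.
- rewrite (last_nth (0, 0)) -[_ :: behead _]/(code F) size_behead size_mkseq.
  by rewrite nth_mkseq // Cn.
Qed.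

Lemma uniq_codes (K : finFieldType) (m : nat) : uniq (codes K m).
Proof. by apply: uniq_cons_pairs => [|u]; [exact: enum_uniq | exact: uniq_walks]. Qed.

Lemma size_codes (K : finFieldType) (m : nat) :
  (#|K|.+1%:Z * (size (codes K m))%:Z = (#|K|%:Z - 1) * (#|K|%:Z ^+ m - (-1) ^+ m))%R.
Proof.
rewrite size_cons_pairs (reindex_onto (fun x => (x, 0)) fst) /=; last first.
  by move=> [a b] /= /andP[_ /eqP ->].
rewrite (big_morph Posz PoszD (erefl _)) mulr_sumr.
under eq_bigl => x do rewrite !eqxx !andbT.
under eq_bigr => x x0 do
  rewrite size_walks /= ?xpair_eqE (negPf x0) //.
rewrite sumr_const -mulr_natl natz; congr (_ * _); last by ring.
rewrite -[#|_|]/#|predC1 (0 : K)| cardC1.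
have : (0 < #|K|)%N by apply/card_gt0P; exists 0.
by case: #|K| => // k _; lia.
Qed.

Unset Implicit Arguments.
Set Strict Implicit.

Theorem theorem1p5 (K : finFieldType) (q : nat) (hq : #|K| = q)
    (n : nat) (hn : (2 <= n)%N) :
  exists N : nat,
    (tame_friezes K n #= `I_N)%card /\
    N%:R = (q%:R - 1) * (q%:R ^+ (n - 1) + (-1) ^+ n) / (q%:R + 1) :> rat.
Proof.
case: n hn => [|[|m]] // _; exists (size (codes K m.+1)); split.
  apply: (@card_eq_trans _ _ _ _ (@code K m.+2 @` tame_friezes K m.+2)%classic).
    by rewrite card_eq_sym; apply/inj_card_eq/code_inj.
  rewrite (_ : (_ @` _)%classic = [set` [fset s in codes K m.+1]%fset]%classic).
    by apply/card_eq_fsetP; rewrite [LHS]card_fseq undup_id ?uniq_codes.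
  apply/seteqP; split=> s /=; rewrite inE.
    by move=> Fs; apply/mem_codes.
  by move/mem_codes.
have q1 : q%:R + 1 != 0 :> rat by rewrite natr1 pnatr_eq0.
apply: (mulIf q1); rewrite mulfVK // subn1 /= -hq.
have := congr1 (intr : int -> rat) (size_codes K m.+1).
rewrite !(intrM, rmorphB, rmorphXn, rmorphN, rmorph1) /= -!pmulrn => eN.
by rewrite natr1 mulrC eN [(-1) ^+ m.+2]exprS mulN1r.
Qed.
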